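(* There exists a universal constant $\kappa \le 1536$ such that the following holds. Let $\{X_n\}_{n\ge 1}$ be a sequence of pairwise independent real-valued random variables on a probability space $(\Omega,\mathbf{F},\mathbb{P})$, and let $\tau,\sigma>0$ be such that $\mathbb{E}(X_n)=0$, $\mathbb{E}(|X_n|)\le \tau$ and $\mathrm{Var}(X_n)\le \sigma^2$ for all $n\ge 1$. Then for all $0<\varepsilon\le \tau$ and all integers $n\ge 1$, $$P^*_{n,\varepsilon}\le \frac{\kappa\sigma^2\tau}{n\varepsilon^3}.$$
   Context: For a sequence of random variables $\{X_n\}_{n\ge1}$, put $S_n:=\sum_{i=1}^n X_i$ and, for $\varepsilon>0$ and $n\ge 1$, $P^*_{n,\varepsilon}:=\mathbb{P}\left(\sup_{m\ge n}\left|\frac{S_m}{m}\right|>\varepsilon\right)$. *)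

(* Defs.v *)
From HB Require Import structures.
From mathcomp Require Import all_boot all_order all_algebra.
From mathcomp Require Import all_classical all_reals all_analysis.

Set Implicit Arguments.
Unset Strict Implicit.
Unset Printing Implicit Defensive.

Import Order.TTheory GRing.Theory Num.Theory.
Import numFieldNormedType.Exports.

Local Open Scope classical_set_scope.
Local Open Scope ring_scope.

(* Sequences are indexed from 1: the term [X 0] of a family [X : nat -> _] is
   junk, and neither the definitions nor the hypotheses involve it. *)
Section defs.
Context (d : measure_display) (T : measurableType d) (R : realType)
  (P : probability T R).

Definition indep_RV (X Y : {RV P >-> R}) : Prop :=
  forall A B : set R, measurable A -> measurable B ->
    P ((X @^-1` A) `&` (Y @^-1` B)) = (P (X @^-1` A) * P (Y @^-1` B))%E.

Definition pairwise_indep (X : nat -> {RV P >-> R}) : Prop :=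
  forall i j : nat, (1 <= i)%N -> (1 <= j)%N -> i != j -> indep_RV (X i) (X j).

Definition partial_sum (X : nat -> {RV P >-> R}) (n : nat) (w : T) : R :=
  \sum_(1 <= i < n.+1) X i w.

(* The supremum is taken in the extended reals, as it may be infinite. *)
Definition Pstar (X : nat -> {RV P >-> R}) (n : nat) (eps : R) : \bar R :=
  P [set w | (eps%:E <
    ereal_sup [set `|partial_sum X m w / m%:R|%:E | m in [set m | (n <= m)%N]])%E].

End defs.

(* Main.v *)
Require Import Defs.
From HB Require Import structures.
From mathcomp Require Import all_boot all_order all_algebra.
From mathcomp Require Import all_classical all_reals all_analysis.
From mathcomp Require Import measurable_realfun.
From mathcomp Require Import ring lra.

(** The proof is a quantitative version of Etemadi's argument for the strong
law of large numbers, and it gives the constant 480.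

Split each [X i] into its positive and negative parts.  Each of the two
families is nonnegative, has means at most [tau] and variances at most
[sigma ^+ 2] (because [X i] is centered), and is still pairwise independent,
hence uncorrelated.  The positive and negative parts of [X i] have the same
mean, so a deviation of [S_m] by more than [m * eps] forces one of the two
families to deviate from its mean by more than [m * (eps / 2)].

The gain is that the partial sums of a nonnegative family are monotone.  Cut
the integers [m >= n] into blocks whose relative length is at most
[delta := eps / (2 * tau)].  Inside a block the mean of the partial sum varies
by at most half of the allowed deviation, so by monotonicity a deviation at some
[m] in the block forces one of size [a * eps / 2] at the first index [a] or at
the last index of the block ([deviation_at_endpoint]).  Only two indices per
block remain, and Chebyshev's inequality bounds their contribution by a constant
times [sigma ^+ 2 / (eps ^+ 2 * a)].  The first indices grow at least like
[n * (1 + delta) ^ j], so the sum of their inverses is of order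
[1 / (n * delta)] ([sum_inv_block]), which is where the last factor [tau / eps]
comes from.  [ge0_uncorrelated_tail] assembles these steps. *)

Import Order.TTheory GRing.Theory Num.Theory.
Import numFieldNormedType.Exports.

Local Open Scope classical_set_scope.
Local Open Scope ring_scope.

(** * Independence and second moments *)

Section second_moments.
Context {d : measure_display} {T : measurableType d} {R : realType}
  {P : probability T R}.

(** The product rule says that the joint law of [(X, Y)] agrees on rectangles
with the product of the marginal laws, hence equals it; Tonelli's theorem then
factors the integral.  Nonnegativity makes this valid without any
integrability assumption. *)
Lemma ge0_integral_indep_mul {d1 d2 : measure_display}
    {T1 : measurableType d1} {T2 : measurableType d2}
    (X : {RV P >-> T1}) (Y : {RV P >-> T2}) (g : T1 -> R) (h : T2 -> R) :
  (forall A B, measurable A -> measurable B ->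
    P ((X @^-1` A) `&` (Y @^-1` B)) = (P (X @^-1` A) * P (Y @^-1` B))%E) ->
  measurable_fun [set: T1] g -> measurable_fun [set: T2] h ->
  (forall x, 0 <= g x) -> (forall y, 0 <= h y) ->
  (\int[P]_w (g (X w) * h (Y w))%:E =
   (\int[P]_w (g (X w))%:E) * (\int[P]_w (h (Y w))%:E))%E.
Proof.
move=> iXY mg mh g0 h0.
pose XY := fun w : T => (X w, Y w).
have mXY : measurable_fun [set: T] XY by exact: measurable_fun_pair.
pose XYm : {mfun T >-> (T1 * T2)%type} := mfun_Sub (mem_set mXY).
pose muX := distribution P X; pose muY := distribution P Y.
have muXYE A : measurable A -> (muX \x muY)%E A = distribution P XYm A.
  apply: product_measure_unique => B C mB mC.
  by rewrite -(iXY B C mB mC).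
pose f := fun z : T1 * T2 => (g z.1 * h z.2)%:E.
have mf : measurable_fun [set: T1 * T2] f.
  apply/measurable_EFinP; apply: measurable_funM.
    exact: (measurableT_comp mg).
  exact: (measurableT_comp mh).
have f0 z : (0 <= f z)%E by rewrite lee_fin mulr_ge0.
transitivity (\int[distribution P XYm]_z f z)%E.
  by rewrite ge0_integral_distribution.
transitivity (\int[muX \x muY]_z f z)%E.
  by apply: eq_measure_integral => A mA _; exact/esym/muXYE.
rewrite fubini_tonelli1//.
have mEg : measurable_fun [set: T1] (EFin \o g) by exact/measurable_EFinP.
have mEh : measurable_fun [set: T2] (EFin \o h) by exact/measurable_EFinP.
have -> : (\int[P]_w (g (X w))%:E)%E = (\int[muX]_x (g x)%:E)%E.
  by rewrite ge0_integral_distribution// => y; rewrite lee_fin.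
have -> : (\int[P]_w (h (Y w))%:E)%E = (\int[muY]_y (h y)%:E)%E.
  by rewrite ge0_integral_distribution// => y; rewrite lee_fin.
rewrite -ge0_integralZr//; last 2 first.
  by move=> x _; rewrite lee_fin.
  by apply: integral_ge0 => y _; rewrite lee_fin.
apply: eq_integral => x _.
rewrite -ge0_integralZl//; last by rewrite lee_fin.
  by move=> y _; rewrite lee_fin.
Qed.

Lemma Lfun1_of_Lfun2 (f : T -> R) : f \in Lfun P 2%:E -> f \in Lfun P 1.
Proof. by apply: Lfun_subset12; exact: fin_num_measure. Qed.

Lemma ge0_covariance_indep (X Y : {RV P >-> R}) (g h : R -> R) :
  indep_RV X Y ->
  measurable_fun [set: R] g -> measurable_fun [set: R] h ->
  (forall x, 0 <= g x) -> (forall x, 0 <= h x) ->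
  g \o X \in Lfun P 2%:E -> h \o Y \in Lfun P 2%:E ->
  covariance P (g \o X) (h \o Y) = 0%E.
Proof.
move=> iXY mg mh g0 h0 gX2 hY2.
have gX1 := Lfun1_of_Lfun2 _ gX2; have hY1 := Lfun1_of_Lfun2 _ hY2.
rewrite covarianceE//; last exact: Lfun2_mul_Lfun1.
have -> : 'E_P[(g \o X) * (h \o Y)]%E = ('E_P[g \o X] * 'E_P[h \o Y])%E.
  by rewrite unlock; exact: ge0_integral_indep_mul.
by rewrite subee// fin_numM// expectation_fin_num.
Qed.

Lemma Lfun2_of_sqr (f : T -> R) : measurable_fun [set: T] f ->
  ('E_P[f ^+ 2] < +oo)%E -> f \in Lfun P 2%:E.
Proof.
move=> mf foo; rewrite inE; apply/andP; split; rewrite inE//=.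
rewrite /finite_norm unlock poweR_lty//.
rewrite (le_lt_trans _ foo)// unlock le_eqVlt; apply/orP; left; apply/eqP.
apply: eq_integral => x _ /=.
by rewrite powR_mulrn// real_normK// num_real.
Qed.

Lemma expectation_sqr_le (f g : T -> R) :
  measurable_fun [set: T] f -> measurable_fun [set: T] g ->
  (forall w, `|g w| <= `|f w|) -> ('E_P[g ^+ 2] <= 'E_P[f ^+ 2])%E.
Proof.
move=> mf mg gf; apply: expectation_le.
- exact: (measurable_funM mg mg).
- exact: (measurable_funM mf mf).
- by move=> w; exact: sqr_ge0.
- by move=> w; exact: sqr_ge0.
- apply: aeW => w /=; rewrite !fctE -[leLHS]real_normK ?num_real//.
  by rewrite -[leRHS]real_normK ?num_real// lerXn2r// nnegrE.
Qed.

Lemma variance_le_sqr (f : T -> R) : f \in Lfun P 2%:E ->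
  ('V_P[f] <= 'E_P[f ^+ 2])%E.
Proof.
by move=> f2; rewrite varianceE// leeBlDr ?leeDl ?sqre_ge0//
  fin_numX// expectation_fin_num// Lfun1_of_Lfun2.
Qed.

Lemma variance_centered (f : T -> R) : ('E_P[f] = 0)%E ->
  ('V_P[f] = 'E_P[f ^+ 2])%E.
Proof.
move=> f0; rewrite /variance [in LHS]unlock f0/=.
by have -> : f \- cst 0 = f by apply/funext => w /=; rewrite subr0.
Qed.

Lemma chebyshev_Lfun (f : T -> R) (e : R) : f \in Lfun P 2%:E -> 0 < e ->
  (P [set w | (e <= `|f w - fine 'E_P[f]%E|)%R] <= (e ^- 2)%:E * 'V_P[f])%E.
Proof.
move=> f2 e0.
pose F : {RV P >-> R} := mfun_Sub (sub_Lfun_mfun f2).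
exact: (chebyshev F e0).
Qed.

End second_moments.

(** * Partial sums of uncorrelated functions *)

Definition psum {T : Type} {R : realType} (Y : nat -> T -> R) (n : nat) :
    T -> R :=
  fun w => \sum_(1 <= i < n.+1) Y i w.

Section uncorrelated_sums.
Context {d : measure_display} {T : measurableType d} {R : realType}
  {P : probability T R}.
Variable Y : nat -> T -> R.
Hypothesis Y2 : forall i, (1 <= i)%N -> Y i \in Lfun P 2%:E.

Lemma psumS n : psum Y n.+1 = psum Y n \+ Y n.+1.
Proof. by apply/funext => w; rewrite /psum big_nat_recr. Qed.

Lemma psum0 : psum Y 0 = cst 0.
Proof. by apply/funext => w; rewrite /psum big_geq. Qed.

Lemma psum_Lfun2 n : psum Y n \in Lfun P 2%:E.
Proof.
elim: n => [|n ih]; first by rewrite psum0 Lfun_cst.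
by rewrite psumS rpredD ?lee1n//= => _; exact: Y2.
Qed.

Lemma expectation_psum n :
  fine 'E_P[psum Y n] = \sum_(1 <= i < n.+1) fine 'E_P[Y i].
Proof.
elim: n => [|n ih]; first by rewrite psum0 expectation_cst big_geq.
have S1 := Lfun1_of_Lfun2 _ (psum_Lfun2 n).
have Y1 : Y n.+1 \in Lfun P 1 by exact/Lfun1_of_Lfun2/Y2.
rewrite psumS expectationD// fineD ?expectation_fin_num//.
by rewrite ih [RHS]big_nat_recr.
Qed.

Hypothesis covY : forall i j, (1 <= i)%N -> (1 <= j)%N -> i != j ->
  covariance P (Y i) (Y j) = 0%E.

Lemma covariance_psum n j : (n < j)%N -> covariance P (psum Y n) (Y j) = 0%E.
Proof.
elim: n => [|n ih] nj; first by rewrite psum0 covariance_cst_l.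
rewrite psumS covarianceDl ?psum_Lfun2 ?Y2 ?(leq_trans _ nj)//.
by rewrite ih ?(ltn_trans _ nj)// covY ?add0e ?(leq_trans _ nj)// neq_ltn nj.
Qed.

Lemma variance_psum_le (v : R) n :
  (forall i, (1 <= i)%N -> ('V_P[Y i] <= v%:E)%E) ->
  ('V_P[psum Y n] <= (n%:R * v)%:E)%E.
Proof.
move=> Vv; elim: n => [|n ih]; first by rewrite psum0 variance_cst mul0r.
rewrite psumS varianceD ?psum_Lfun2 ?Y2// covariance_psum// mule0 adde0.
by rewrite -natr1 mulrDl mul1r EFinD leeD ?Vv.
Qed.

End uncorrelated_sums.

(** * Blocks of small relative length *)

Section blocks.
Context {R : realType}.
Variables (delta : R) (n : nat).
Hypotheses (delta0 : 0 < delta) (n0 : (0 < n)%N).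

(** First indices of consecutive blocks of integers starting at [n].  The block
[j] runs from [block j] to [(block j.+1).-1].  The successor in the recursion
keeps a block nonempty even when [delta * block j < 1], and makes up for the
integer part in [block_growth]. *)
Fixpoint block (j : nat) : nat :=
  if j is i.+1 then (block i + Num.truncn (delta * (block i)%:R)).+1 else n.

Lemma ltn_blockS j : (block j < block j.+1)%N.
Proof. by rewrite /= ltnS leq_addr. Qed.

Lemma block_gt0 j : (0 < block j)%N.
Proof. by case: j. Qed.

Lemma block_growth j : (1 + delta) * (block j)%:R <= (block j.+1)%:R :> R.
Proof.
rewrite /= -addnS natrD mulrDl mul1r lerD2l.
by apply: ltW; exact: truncnS_gt.
Qed.

Lemma block_length j : (block j.+1).-1%:R <= (1 + delta) * (block j)%:R :> R.
Proof.
rewrite /= natrD mulrDl mul1r lerD2l.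
by rewrite truncn_le// mulr_ge0// ltW.
Qed.

Lemma block_cover m : (n <= m)%N -> exists j, (block j <= m < block j.+1)%N.
Proof.
move=> nm.
have : exists j, (m < block j)%N.
  exists m.+1; elim: m {nm} => [|m ih].
    exact: leq_ltn_trans (ltn_blockS 0).
  exact: leq_ltn_trans ih (ltn_blockS _).
move/ex_minnP => [[|j] mj jmin]; first by move: mj; rewrite ltnNge nm.
exists j; rewrite mj andbT leqNgt; apply/negP => /jmin.
by rewrite ltnn.
Qed.

(** The growth of the blocks gives
[1 / a_j <= C * (1 / a_j - 1 / a_(j+1))] with [C := (1 + delta) / delta], so
that the sum telescopes. *)
Lemma sum_inv_block N :
  \sum_(0 <= j < N) (block j)%:R^-1 <= (1 + delta) / delta * n%:R^-1 :> R.
Proof.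
pose C := (1 + delta) / delta.
have C0 : 0 < C by rewrite divr_gt0// addr_gt0.
suff : \sum_(0 <= j < N) (block j)%:R^-1 <=
    C * (n%:R^-1 - (block N)%:R^-1) :> R.
  move=> /le_trans; apply; rewrite ler_pM2l// gerBl invr_ge0//.
elim: N => [|N ih]; first by rewrite big_geq// subrr mulr0.
rewrite big_nat_recr//=.
have a0 : 0 < (block N)%:R :> R by rewrite ltr0n block_gt0.
have b0 : 0 < (block N.+1)%:R :> R by rewrite ltr0n block_gt0.
have inc : (block N)%:R^-1 <= C * ((block N)%:R^-1 - (block N.+1)%:R^-1) :> R.
  have d1 : 0 < 1 + delta by rewrite addr_gt0.
  have : (block N.+1)%:R^-1 <= ((1 + delta) * (block N)%:R)^-1 :> R.
    by rewrite lef_pV2 ?posrE ?mulr_gt0// block_growth.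
  move=> h.
  rewrite [leLHS](_ : _ =
      C * ((block N)%:R^-1 - ((1 + delta) * (block N)%:R)^-1)).
    by rewrite ler_pM2l// lerD2l lerN2.
  by rewrite /C; field; rewrite !lt0r_neq0.
apply: (le_trans (lerD ih inc)).
by rewrite -mulrDr addrA subrK.
Qed.

Lemma nneseries_inv_block (c : R) : 0 <= c ->
  (\sum_(0 <= j <oo) (c / (block j)%:R)%:E <=
   (c * ((1 + delta) / delta * n%:R^-1))%:E)%E.
Proof.
move=> c0.
apply: lime_le.
  by apply: is_cvg_nneseries => j _ _; rewrite lee_fin divr_ge0.
apply: nearW => N; rewrite sumEFin lee_fin -mulr_sumr.
by rewrite ler_wpM2l// sum_inv_block.
Qed.

End blocks.

(** Since [s] is monotone and [e] grows at rate at most [tau], an excess of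
[s m] over [e m] persists up to [b], and a deficit was already present at [a],
up to a loss of [(b - a) * tau]. *)
Lemma deviation_at_endpoint {R : realType} (s e : nat -> R) (tau eta c : R)
    (a m b : nat) :
  (a <= m <= b)%N ->
  {homo s : i j / (i <= j)%N >-> i <= j} ->
  (forall i j, (i <= j)%N -> e j - e i <= (j%:R - i%:R) * tau) ->
  0 <= tau -> (b%:R - a%:R) * tau + eta <= c -> c < `|s m - e m| ->
  eta <= `|s a - e a| \/ eta <= `|s b - e b|.
Proof.
move=> /andP[am mb] smono elip tau0 hc hdev.
have sam := smono _ _ am; have smb := smono _ _ mb.
have eam := elip _ _ am; have emb := elip _ _ mb.
have rm : a%:R <= m%:R :> R by rewrite ler_nat.
have rb : m%:R <= b%:R :> R by rewrite ler_nat.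
have h1 : (m%:R - a%:R) * tau <= (b%:R - a%:R) * tau.
  by rewrite ler_wpM2r// lerD2r.
have h2 : (b%:R - m%:R) * tau <= (b%:R - a%:R) * tau.
  by rewrite ler_wpM2r// lerD2l lerN2.
have [ge0|lt0] := leP 0 (s m - e m).
- right; rewrite (le_trans _ (ler_norm _))//.
  by move: hdev; rewrite ger0_norm// => hdev; lra.
- left; rewrite -normrN (le_trans _ (ler_norm _))//.
  by move: hdev; rewrite ltr0_norm// => hdev; lra.
Qed.

(** * Tail bound for nonnegative uncorrelated functions *)

Section tail_bound.
Context {d : measure_display} {T : measurableType d} {R : realType}
  {P : probability T R}.

Lemma psum_deviation_le (Y : nat -> T -> R) (v eta : R) (k : nat) :
  (forall i, (1 <= i)%N -> Y i \in Lfun P 2%:E) ->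
  (forall i j, (1 <= i)%N -> (1 <= j)%N -> i != j ->
    covariance P (Y i) (Y j) = 0%E) ->
  (forall i, (1 <= i)%N -> ('V_P[Y i] <= v%:E)%E) ->
  0 < eta ->
  (P [set w | (eta <= `|psum Y k w - fine 'E_P[psum Y k]%E|)%R] <=
    (eta ^- 2 * (k%:R * v))%:E)%E.
Proof.
move=> Y2 cY vY eta0.
apply: (le_trans (chebyshev_Lfun _ _ (psum_Lfun2 _ Y2 k) eta0)).
rewrite [leRHS]EFinM lee_wpmul2l ?lee_fin ?invr_ge0 ?exprn_ge0 ?(ltW eta0)//.
exact: variance_psum_le.
Qed.

Lemma measurable_psum_deviation (Y : nat -> T -> R) (e c : R) k :
  (forall i, (1 <= i)%N -> Y i \in Lfun P 2%:E) ->
  measurable [set w | e <= `|psum Y k w - c|].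
Proof.
move=> Y2.
have mS : measurable_fun [set: T] (fun w => `|psum Y k w - c|).
  apply: measurableT_comp => //; apply: measurable_funB => //.
  by have := sub_Lfun_mfun (psum_Lfun2 _ Y2 k); rewrite inE.
have := mS measurableT `[e, +oo[%classic (measurable_itv _).
rewrite setTI; congr (measurable _).
by apply/seteqP; split => w /=; rewrite in_itv/= andbT.
Qed.

(** The exceptional event is produced as a countable union [U] of measurable
Chebyshev events containing all large deviations, so that the event of interest
need only be included in [U]. *)
Theorem ge0_uncorrelated_tail (Y : nat -> T -> R) (tau v eps : R) (n : nat) :
  (forall i, (1 <= i)%N -> Y i \in Lfun P 2%:E) ->
  (forall i j, (1 <= i)%N -> (1 <= j)%N -> i != j ->
    covariance P (Y i) (Y j) = 0%E) ->
  (forall i w, 0 <= Y i w) ->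
  (forall i, (1 <= i)%N -> ('E_P[Y i] <= tau%:E)%E) ->
  (forall i, (1 <= i)%N -> ('V_P[Y i] <= v%:E)%E) ->
  0 <= v -> 0 < eps -> eps <= tau -> (1 <= n)%N ->
  exists U : set T, [/\ measurable U,
    (forall w m, (n <= m)%N ->
      m%:R * eps < `|psum Y m w - fine 'E_P[psum Y m]%E| -> U w) &
    (P U <= (30 * v * tau / (n%:R * eps ^+ 3))%:E)%E].
Proof.
move=> Y2 cY Y0 tY vY v0 eps0 epstau n1.
have tau0 : 0 < tau by exact: lt_le_trans epstau.
pose delta := eps / (2 * tau).
have delta0 : 0 < delta by rewrite divr_gt0// mulr_gt0.
have delta_le : delta <= 2^-1.
  rewrite /delta ler_pdivrMr ?mulr_gt0//; lra.
pose a := block delta n; pose b j := (a j.+1).-1.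
have a_gt0 j : (0 < a j)%N by exact: block_gt0.
have aR0 j : 0 < (a j)%:R :> R by rewrite ltr0n.
(* A deviation [m * eps] in block [j] is at least [a j * eps]; half of that is
   kept as the threshold, the other half absorbs the variation of the mean. *)
pose eta j : R := (a j)%:R * eps / 2.
have eta0 j : 0 < eta j by rewrite divr_gt0// mulr_gt0.
pose dev k (e : R) :=
  [set w | e <= `|psum Y k w - fine 'E_P[psum Y k]%E|].
have mdev k e : measurable (dev k e) by exact: measurable_psum_deviation.
pose D j := dev (a j) (eta j) `|` dev (b j) (eta j).
have mD j : measurable (D j) by exact: measurableU.
exists (\bigcup_j D j); split; first exact: bigcup_measurable.
- move=> w m nm hdev.
  have [j /andP[ajm mj]] := block_cover delta n m nm.
  exists j => //.
  have mb : (m <= b j)%N by rewrite /b -ltnS prednK.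
  suff : eta j <= `|psum Y (a j) w - fine 'E_P[psum Y (a j)]%E| \/
         eta j <= `|psum Y (b j) w - fine 'E_P[psum Y (b j)]%E|.
    by case; [left|right].
  apply: (@deviation_at_endpoint _ (fun k => psum Y k w)
    (fun k => fine 'E_P[psum Y k]%E) tau (eta j) (m%:R * eps) (a j) m (b j)).
  + by rewrite ajm.
  + move=> i k ik; rewrite /psum (@big_cat_nat _ _ _ i.+1 1 k.+1)//=.
    by rewrite lerDl sumr_ge0.
  + move=> i k ik; rewrite !expectation_psum//.
    rewrite (@big_cat_nat _ _ _ i.+1 1 k.+1)//= addrAC subrr add0r.
    have -> : (k%:R - i%:R) * tau = \sum_(i.+1 <= l < k.+1) tau.
      by rewrite sumr_const_nat subSS -natrB// mulr_natl.
    apply: ler_sum_nat => l /andP[il _].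
    have l1 : (1 <= l)%N by exact: leq_ltn_trans il.
    by rewrite -lee_fin fineK ?tY// expectation_fin_num// Lfun1_of_Lfun2// Y2.
  + exact: ltW.
  + have := block_length _ n delta0 j; rewrite -/a -/(b j) => hb.
    have : ((b j)%:R - (a j)%:R) * tau <= delta * (a j)%:R * tau.
      by rewrite ler_pM2r//; lra.
    have -> : delta * (a j)%:R * tau = eta j.
      by rewrite /delta /eta; field; rewrite lt0r_neq0.
    move=> h; apply: (le_trans (lerD h (lexx _))).
    rewrite /eta -splitr ler_pM2r// ler_nat//.
  + exact: hdev.
- (* Chebyshev gives [4 / (a j * eps) ^ 2 * (a j + b j) * v], and [delta <= 1/2]
     gives [a j + b j <= 5/2 * a j]: hence the constant 10. *)
  have PD j : (P (D j) <= (10 * v / eps ^+ 2 / (a j)%:R)%:E)%E.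
    have Pdev k : (P (dev k (eta j)) <= (eta j ^- 2 * (k%:R * v))%:E)%E.
      exact: psum_deviation_le.
    apply: (le_trans (measureU2 _ (mdev _ _) (mdev _ _))).
    apply: (le_trans (leeD (Pdev _) (Pdev _))).
    rewrite -EFinD lee_fin -mulrDr -mulrDl.
    have := block_length _ n delta0 j; rewrite -/a -/(b j) => hb.
    have hab : (a j)%:R + (b j)%:R <= 5 / 2 * (a j)%:R :> R.
      have : (1 + delta) * (a j)%:R <= 3 / 2 * (a j)%:R.
        by rewrite ler_pM2r//; lra.
      move: hb; lra.
    have -> : 10 * v / eps ^+ 2 / (a j)%:R =
        eta j ^- 2 * (5 / 2 * (a j)%:R * v).
      by rewrite /eta; field; rewrite !lt0r_neq0.
    rewrite ler_wpM2l ?invr_ge0 ?exprn_ge0 ?(ltW (eta0 j))//.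
    by rewrite ler_wpM2r.
  have c0 : 0 <= 10 * v / eps ^+ 2.
    by rewrite divr_ge0 ?exprn_ge0 ?(ltW eps0)// mulr_ge0.
  apply: le_trans (_ : _ <= \sum_(0 <= j <oo) P (D j))%E _.
    apply: measure_sigma_subadditive; [exact: mD| |by []].
    by apply: bigcup_measurable => j _; exact: mD.
  apply: le_trans (lee_nneseries _ (fun j _ => PD j)) _.
    by move=> j _ _; exact: measure_ge0.
  apply: (le_trans (nneseries_inv_block _ n delta0 n1 _ c0)).
  (* The remaining factor [1 + delta] is at most 3/2. *)
  rewrite lee_fin.
  have n0 : 0 < n%:R :> R by rewrite ltr0n.
  have -> : 30 * v * tau / (n%:R * eps ^+ 3) =
      10 * v / eps ^+ 2 * (3 / 2 / delta * n%:R^-1).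
    by rewrite /delta; field; rewrite !lt0r_neq0.
  rewrite ler_wpM2l// ler_wpM2r ?invr_ge0 ?(ltW n0)//.
  rewrite ler_wpM2r ?invr_ge0 ?(ltW delta0)//.
  lra.
Qed.

End tail_bound.

(** * Reduction to nonnegative variables *)

Section nonneg_image.
Context {d : measure_display} {T : measurableType d} {R : realType}
  {P : probability T R}.

(** For a centered [X] the variance is the second moment, and second moments
only see absolute values. *)
Lemma expectation_sqr_image_le (X : {RV P >-> R}) (h : R -> R) (v : R) :
  measurable_fun [set: R] h -> (forall x, `|h x| <= `|x|) ->
  ('E_P[X] = 0)%E -> ('V_P[X] <= v%:E)%E ->
  ('E_P[((h \o X) ^+ 2)%R] <= v%:E)%E.
Proof.
move=> mh hle EX VX; rewrite (le_trans (expectation_sqr_le X (h \o X) _ _ _))//.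
- exact: measurableT_comp.
- by move=> w; exact: hle.
- by rewrite -variance_centered.
Qed.

Lemma Lfun2_image (X : {RV P >-> R}) (h : R -> R) (v : R) :
  measurable_fun [set: R] h -> (forall x, `|h x| <= `|x|) ->
  ('E_P[X] = 0)%E -> ('V_P[X] <= v%:E)%E -> h \o X \in Lfun P 2%:E.
Proof.
move=> mh hle EX VX; apply: Lfun2_of_sqr; first exact: measurableT_comp.
by rewrite (le_lt_trans (expectation_sqr_image_le _ _ v mh hle EX VX))// ltry.
Qed.

(** Pairwise independence passes to [h \o X i], which is nonnegative, so
[ge0_uncorrelated_tail] applies; it is used with [h] the positive and the
negative part. *)
Lemma ge0_image_tail (X : nat -> {RV P >-> R}) (h : R -> R)
    (tau sigma eps : R) (n : nat) :
  measurable_fun [set: R] h -> (forall x, 0 <= h x <= `|x|) ->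
  pairwise_indep X ->
  (forall i, (1 <= i)%N -> ('E_P[X i] = 0)%E) ->
  (forall i, (1 <= i)%N -> ('E_P[(fun w => `|X i w|)%R] <= tau%:E)%E) ->
  (forall i, (1 <= i)%N -> ('V_P[X i] <= (sigma ^+ 2)%:E)%E) ->
  0 < eps -> eps <= tau -> (1 <= n)%N ->
  exists U : set T, [/\ measurable U,
    (forall w m, (n <= m)%N ->
      m%:R * eps < `|psum (fun i => h \o X i) m w
                     - fine 'E_P[psum (fun i => h \o X i) m]%E| -> U w) &
    (P U <= (30 * sigma ^+ 2 * tau / (n%:R * eps ^+ 3))%:E)%E].
Proof.
move=> mh hle iX EX EaX VX eps0 epstau n1.
have h0 x : 0 <= h x by case/andP: (hle x).
have hle' x : `|h x| <= `|x| by rewrite ger0_norm//; case/andP: (hle x).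
have hX2 i : (1 <= i)%N -> h \o X i \in Lfun P 2%:E.
  by move=> i1; exact: Lfun2_image (EX i i1) (VX i i1).
apply: (ge0_uncorrelated_tail (fun i => h \o X i) tau (sigma ^+ 2) eps n) => //.
- move=> i j i1 j1 ij; apply: ge0_covariance_indep => //; [|exact: hX2..].
  exact: iX.
- by move=> i w; exact: h0.
- move=> i i1; apply: le_trans (EaX i i1); apply: expectation_le => //.
  + by apply: measurableT_comp => //; exact: measurable_funPT.
  + by apply: measurableT_comp => //; exact: measurable_funPT.
  + by move=> w; exact: h0.
  + by apply: aeW => w /=; case/andP: (hle (X i w)).
- move=> i i1; rewrite (le_trans (variance_le_sqr _ (hX2 i i1)))//.
  by rewrite expectation_sqr_image_le// ?EX ?VX.
- exact: sqr_ge0.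
Qed.

Lemma measurable_sup_partial_sum (X : nat -> {RV P >-> R}) (n : nat) (eps : R) :
  measurable [set w | (eps%:E <
    ereal_sup [set `|partial_sum X m w / m%:R|%:E | m in [set m | (n <= m)%N]])%E].
Proof.
rewrite (_ : mkset _ = \bigcup_(m in [set m | (n <= m)%N])
    ((fun w => `|partial_sum X m w / m%:R|) @^-1` `]eps, +oo[%classic)).
  apply: bigcup_measurable => m _; rewrite -[X in measurable X]setTI.
  suff mS : measurable_fun [set: T] (fun w => `|partial_sum X m w / m%:R|).
    by apply: mS => //; exact: measurable_itv.
  apply: measurableT_comp => //; apply: measurable_funM => //.
  by apply: measurable_sum => i; exact: measurable_funPT.
apply/seteqP; split => w /=.
- move=> /ereal_sup_gt[_ [m nm <-]]; rewrite lte_fin => h.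
  by exists m => //=; rewrite in_itv/= h.
- move=> [m /= nm]; rewrite in_itv/= andbT -lte_fin => /lt_le_trans; apply.
  by apply: ereal_sup_ubound; exists m.
Qed.

End nonneg_image.

Theorem theorem1p4 (R : realType) :
  exists kappa : R, kappa <= 1536 /\
    forall (d : measure_display) (T : measurableType d) (P : probability T R)
      (X : nat -> {RV P >-> R}) (tau sigma : R),
      0 < tau -> 0 < sigma ->
      pairwise_indep X ->
      (forall n : nat, (1 <= n)%N -> ('E_P[X n] = 0)%E) ->
      (forall n : nat, (1 <= n)%N -> ('E_P[(fun w => `|X n w|)%R] <= tau%:E)%E) ->
      (forall n : nat, (1 <= n)%N -> ('V_P[X n] <= (sigma ^+ 2)%:E)%E) ->
      forall (eps : R) (n : nat), 0 < eps -> eps <= tau -> (1 <= n)%N ->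
        (Pstar X n eps <= (kappa * sigma ^+ 2 * tau / (n%:R * eps ^+ 3))%:E)%E.
Proof.
(* [480 = 2 * 30 * 2 ^ 3]: two families, each taken at level [eps / 2]. *)
exists 480; split; first by lra.
move=> d T P X tau sigma tau0 sigma0 iX EX EaX VX eps n eps0 epstau n1.
pose pos (x : R) := Num.max x 0; pose neg (x : R) := Num.max (- x) 0.
have mpos : measurable_fun [set: R] pos by exact: measurable_maxr.
have mneg : measurable_fun [set: R] neg by exact: measurable_maxr.
have posle x : 0 <= pos x <= `|x|.
  by rewrite /pos le_max lexx orbT ge_max ler_norm normr_ge0.
have negle x : 0 <= neg x <= `|x|.
  by rewrite /neg le_max lexx orbT ge_max -normrN ler_norm normr_ge0.
have pos_neg x : pos x - neg x = x.
  by rewrite /pos /neg; case: (leP x 0) => x0; case: (leP (- x) 0) => x1; lra.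
have pos2 i : (1 <= i)%N -> pos \o X i \in Lfun P 2%:E.
  move=> i1; apply: Lfun2_image (EX i i1) (VX i i1) => // x.
  by case/andP: (posle x) => p0 ?; rewrite ger0_norm.
have neg2 i : (1 <= i)%N -> neg \o X i \in Lfun P 2%:E.
  move=> i1; apply: Lfun2_image (EX i i1) (VX i i1) => // x.
  by case/andP: (negle x) => p0 ?; rewrite ger0_norm.
have e0 : 0 < eps / 2 by rewrite divr_gt0.
have etau : eps / 2 <= tau by lra.
have [U [mU hU PU]] := ge0_image_tail X pos tau sigma (eps / 2) n
  mpos posle iX EX EaX VX e0 etau n1.
have [V [mV hV PV]] := ge0_image_tail X neg tau sigma (eps / 2) n
  mneg negle iX EX EaX VX e0 etau n1.
have sub : [set w | (eps%:E <
    ereal_sup [set `|partial_sum X m w / m%:R|%:E | m in [set m | (n <= m)%N]])%E]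
    `<=` U `|` V.
  move=> w /= /ereal_sup_gt[_ [m /= nm <-]]; rewrite lte_fin => hm.
  have m0 : 0 < m%:R :> R by rewrite ltr0n (leq_trans n1 nm).
  have {}hm : m%:R * eps < `|partial_sum X m w|.
    by move: hm; rewrite normrM normfV (gtr0_norm m0) ltr_pdivlMr// mulrC.
  set p := psum (fun i => pos \o X i) m; set q := psum (fun i => neg \o X i) m.
  have Spq : partial_sum X m w = p w - q w.
    rewrite /p /q /psum /partial_sum -sumrB; apply: eq_bigr => i _.
    by rewrite /= pos_neg.
  (* The means cancel because [X i] is centered. *)
  have Epq : fine 'E_P[p]%E = fine 'E_P[q]%E.
    rewrite !expectation_psum//; apply: eq_big_nat => i /andP[i1 _].
    have p1 := Lfun1_of_Lfun2 _ (pos2 i i1).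
    have q1 := Lfun1_of_Lfun2 _ (neg2 i i1).
    apply/eqP; rewrite -subr_eq0 -fineB ?expectation_fin_num//.
    rewrite -expectationB// (_ : _ \- _ = X i :> (T -> R)) ?EX//.
    by apply/funext => w' /=; rewrite pos_neg.
  have [hp|hp] := ltP (m%:R * (eps / 2)) `|p w - fine 'E_P[p]%E|.
    by left; exact: hU nm hp.
  have [hq|hq] := ltP (m%:R * (eps / 2)) `|q w - fine 'E_P[q]%E|.
    by right; exact: hV nm hq.
  suff : m%:R * eps < m%:R * eps by rewrite ltxx.
  rewrite (lt_le_trans hm)// Spq.
  have -> : p w - q w = (p w - fine 'E_P[p]%E) - (q w - fine 'E_P[q]%E).
    by rewrite Epq; ring.
  rewrite (le_trans (ler_normB _ _))// (le_trans (lerD hp hq))//.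
  by rewrite -mulrDr -splitr.
rewrite /Pstar; apply: (@le_trans _ _ (P (U `|` V))).
  apply: le_measure sub; rewrite inE; last exact: measurableU.
  exact: measurable_sup_partial_sum.
apply: (le_trans (measureU2 _ mU mV)).
apply: (le_trans (leeD PU PV)).
rewrite -EFinD lee_fin le_eqVlt; apply/orP; left; apply/eqP.
have n0 : 0 < n%:R :> R by rewrite ltr0n.
by field; rewrite !lt0r_neq0.
Qed.
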